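(* Let $G_1$ be an $r_1$-regular graph on $n_1$ vertices and $m_1$ edges, and $G_2$ an arbitrary graph on $n_2$ vertices. Then $$Kf(G_1\underline{\vee} G_2)=(m_1+n_1+n_2)\left(\frac{m_1-n_1}{2+n_2}+\frac{2+r_1+m_1+n_2}{r_1n_2+r_1m_1+2m_1}+\sum_{i=2}^{n_2}\frac{1}{m_1+\mu_i(G_2)}+\sum_{i=2}^{n_1}\frac{2+r_1+n_2}{r_1n_2+\mu_i(G_1)}\right).$$
   Context: All graphs are simple and undirected. For a graph $G$ on $n$ vertices, $0=\mu_1(G)\le\mu_2(G)\le\cdots\le\mu_n(G)$ are the eigenvalues of the Laplacian matrix $L(G)=D(G)-A(G)$, where $D(G)$ is the diagonal matrix of vertex degrees and $A(G)$ is the adjacency matrix. The Kirchhoff index $Kf(G)$ of a graph $G$ is the sum of the resistance distances between all pairs of vertices (the resistance distance being the effective resistance when each edge is a unit resistor); for a connected graph $G$ on $n\ge 2$ vertices it is known that $Kf(G)=n\sum_{i=2}^{n}\frac{1}{\mu_i(G)}$. The subdivision graph $\mathcal{S}(G)$ of $G$ is the graph obtained by inserting a new vertex into every edge of $G$; $I(G)$ denotes the set of inserted vertices. For vertex-disjoint graphs $G_1$ and $G_2$, the subdivision-edge join $G_1\underline{\vee}G_2$ is the graph obtained from $\mathcal{S}(G_1)$ and $G_2$ by joining every vertex of $I(G_1)$ with every vertex of $V(G_2)$, the vertex set of $G_2$. *)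

(* Defs.v *)
From mathcomp Require Import all_boot all_order all_algebra.
From mathcomp Require Import boolp classical_sets.

Set Implicit Arguments.
Unset Strict Implicit.
Unset Printing Implicit Defensive.

Import Order.TTheory GRing.Theory Num.Theory.
Local Open Scope ring_scope.

Record sgraph := SGraph {
  vertex :> finType;
  adj : rel vertex;
  adj_sym : symmetric adj;
  adj_irrefl : irreflexive adj }.

Arguments adj {s} x y.

Section Graph.
Variable G : sgraph.

Definition edges : {set {set G}} :=
  [set [set p.1; p.2] | p in [pred p : G * G | adj p.1 p.2]].

Definition degree (x : G) : nat := #|[set y | adj x y]|.

Definition regular (r : nat) : Prop := forall x : G, degree x = r.

End Graph.

Section Laplacian.
Variables (R : rcfType) (G : sgraph).

Definition adj_mx : 'M[R]_#|G| :=
  \matrix_(i, j) (adj (enum_val i) (enum_val j))%:R.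

Definition degree_mx : 'M[R]_#|G| :=
  diag_mx (\row_i (degree (enum_val i))%:R).

Definition laplacian : 'M[R]_#|G| := degree_mx - adj_mx.

Definition eigenvalues_of n (A : 'M[R]_n) (s : seq R) : Prop :=
  sorted <=%R s /\ char_poly A = \prod_(x <- s) ('X - x%:P).

(* The default [::] is never used: a Laplacian is symmetric, hence its
   characteristic polynomial splits over R. *)
Definition laplacian_spectrum : seq R :=
  xget [::] [set s | eigenvalues_of laplacian s]%classic.

(* Numbered from 1, so that mu 1 <= mu 2 <= ... <= mu #|G|. *)
Definition mu (i : nat) : R := nth 0 laplacian_spectrum i.-1.

(* p is a potential on the network with a unit resistor on each edge, when a
   unit current enters at u and leaves at v. By Ohm's law the current from x
   to y along an edge is p x - p y; the equation is the current law at x. *)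
Definition unit_current_potential (u v : G) (p : G -> R) : Prop :=
  forall x : G,
    \sum_(y | adj x y) (p x - p y) = (x == u)%:R - (x == v)%:R.

(* Effective resistance; the default 0 is only taken when u and v lie in
   different components, where the effective resistance is infinite. *)
Definition resistance (u v : G) : R :=
  xget 0 [set r | exists2 p, unit_current_potential u v p
                           & r = p u - p v]%classic.

(* Comparing ranks makes each unordered pair of vertices count once. *)
Definition kirchhoff_index : R :=
  \sum_(u : G) \sum_(v : G | (enum_rank u < enum_rank v)%N) resistance u v.

End Laplacian.

Arguments mu R G i : clear implicits.
Arguments kirchhoff_index R G : clear implicits.

Lemma eigenvalues_of_inj (R : rcfType) n (A : 'M[R]_n) (s t : seq R) :
  eigenvalues_of A s -> eigenvalues_of A t -> s = t.
Proof.
move=> [s_sorted eq_s] [t_sorted eq_t].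
apply: (le_sorted_eq s_sorted t_sorted).
by apply: prod_XsubC_eq; rewrite -eq_s -eq_t.
Qed.

Lemma resistanceE (R : rcfType) (G : sgraph) (u v : G) (p : G -> R) :
  unit_current_potential u v p -> resistance R u v = p u - p v.
Proof.
have drop (p1 q1 : G -> R) : unit_current_potential u v p1 ->
    \sum_x \sum_(y | adj x y) (p1 x - p1 y) * q1 x = q1 u - q1 v.
  move=> Hp; under eq_bigr => x _ do rewrite -mulr_suml Hp mulrBl.
  rewrite big_split /= sumrN; congr (_ - _).
    by rewrite (bigD1 u) //= eqxx mul1r big1 ?addr0 // => x /negPf->; rewrite mul0r.
  by rewrite (bigD1 v) //= eqxx mul1r big1 ?addr0 // => x /negPf->; rewrite mul0r.
have green (p1 q1 : G -> R) :
    \sum_x \sum_(y | adj x y) (p1 x - p1 y) * q1 x =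
    \sum_x \sum_(y | adj x y) (q1 x - q1 y) * p1 x.
  under eq_bigr => x _ do under eq_bigr => y _ do rewrite mulrBl.
  under [RHS]eq_bigr => x _ do under eq_bigr => y _ do rewrite mulrBl.
  under eq_bigr => x _ do rewrite sumrB.
  under [RHS]eq_bigr => x _ do rewrite sumrB.
  rewrite !sumrB; congr (_ - _).
    by apply: eq_bigr => x _; apply: eq_bigr => y _; rewrite mulrC.
  rewrite (exchange_big_dep predT) //=; apply: eq_bigr => x _.
  by apply: eq_big => [y|y _]; [rewrite adj_sym | rewrite mulrC].
move=> Hp; apply: xget_unique; first by exists p.
by move=> _ [q Hq ->]; rewrite -(drop p q Hp) green (drop q p Hq).
Qed.

Section Subdivision.
Variable G : sgraph.

Definition edge := {e : {set G} | e \in edges G}.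

Definition subdivision_adj (a b : G + edge) : bool :=
  match a, b with
  | inl x, inr e => x \in val e
  | inr e, inl x => x \in val e
  | _, _ => false
  end.

Lemma subdivision_adj_sym : symmetric subdivision_adj.
Proof. by case=> [x|e] [y|f]. Qed.

Lemma subdivision_adj_irrefl : irreflexive subdivision_adj.
Proof. by case. Qed.

Definition subdivision : sgraph :=
  SGraph subdivision_adj_sym subdivision_adj_irrefl.

Definition inserted : {set subdivision} :=
  [set a : G + edge | if a is inr _ then true else false].

End Subdivision.

Section JoinOn.
Variables (G H : sgraph) (A : {set G}).

(* Disjoint union of G and H, plus all edges between A and H. *)
Definition join_on_adj (a b : G + H) : bool :=
  match a, b with
  | inl x, inl y => adj x y
  | inr x, inr y => adj x y
  | inl x, inr _ => x \in A
  | inr _, inl y => y \in A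
  end.

Lemma join_on_adj_sym : symmetric join_on_adj.
Proof. by case=> [x|x] [y|y] //=; apply: adj_sym. Qed.

Lemma join_on_adj_irrefl : irreflexive join_on_adj.
Proof. by case=> [x|x] /=; apply: adj_irrefl. Qed.

Definition join_on : sgraph := SGraph join_on_adj_sym join_on_adj_irrefl.

End JoinOn.

Definition subdivision_edge_join (G1 G2 : sgraph) : sgraph :=
  join_on G2 (inserted G1).

(* Main.v *)
(** The Kirchhoff index can be read off any right inverse [M] of the Laplacian
modulo constants: if [L M = I - w 1^T], then the column difference
[M (e_u - e_v)] is a potential for the unit current from [u] to [v], so
[Kf = N tr M - 1^T M 1]. For the join, with incidence matrix [B] of [G1],
[S = (r n2 + L1)^-1] and [K = (m + L2)^-1], the block matrix
<<
  (2 + n2) S    S B                           J / (n2 m)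
  B^T S         (I + B^T S B) / (2 + n2)      J / (n2 m)
  0             0                             K
>>
is such an inverse, with [w = 1 / n2] on [G2] and [0] elsewhere, because
[B B^T = 2 r - L1]. No spectrum of the join is needed: the traces of [S] and [K]
are sums over the spectra of [L1] and [L2], by the spectral theorem
over [R[i]]. *)

Require Import Defs.
From mathcomp Require Import classical_sets.
From mathcomp Require Import all_boot all_order all_algebra.
From mathcomp Require Import complex ring lra.

Set Implicit Arguments.
Unset Strict Implicit.
Unset Printing Implicit Defensive.

Import Order.TTheory GRing.Theory Num.Theory.
Local Open Scope ring_scope.

(** * Conjugation, resolvent traces and spectra of symmetric matrices *)

Lemma char_poly_conj (F : fieldType) n (P D : 'M[F]_n) :
  P \in unitmx -> char_poly (invmx P *m D *m P) = char_poly D.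
Proof.
move=> Pu; rewrite /char_poly /char_poly_mx !map_mxM /=.
have PP : map_mx polyC (invmx P) *m map_mx polyC P = 1%:M.
  by rewrite -map_mxM mulVmx // map_mx1.
set Q := map_mx polyC (invmx P) in PP *; set P' := map_mx polyC P in PP *.
have XE : 'X%:M = Q *m 'X%:M *m P' by rewrite scalar_mxC -mulmxA PP mulmx1.
transitivity (\det (Q *m ('X%:M - map_mx polyC D) *m P')).
  by rewrite mulmxBr mulmxBl -XE.
by rewrite !det_mulmx mulrAC -det_mulmx PP det1 mul1r.
Qed.

(** Shift and inverse act entrywise on the diagonal factor, and the trace is invariant under
    conjugation. *)
Lemma mxtrace_resolvent_diag (F : fieldType) n (P : 'M[F]_n) (d : 'rV_n) c :
    P \in unitmx -> c%:M + invmx P *m diag_mx d *m P \in unitmx ->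
  \tr (invmx (c%:M + invmx P *m diag_mx d *m P)) = \sum_i (c + d 0 i)^-1.
Proof.
move=> Pu.
have -> : c%:M + invmx P *m diag_mx d *m P =
          invmx P *m diag_mx (\row_i (c + d 0 i)) *m P.
  have -> : \row_i (c + d 0 i) = const_mx c + d.
    by apply/rowP=> i; rewrite !mxE.
  rewrite raddfD /= diag_const_mx mulmxDr mulmxDl scalar_mxC -(mulmxA c%:M).
  by rewrite mulVmx // mulmx1.
set e := \row_i _; rewrite !unitmx_mul unitmx_inv Pu andbT /= => eu.
have e0 i : e 0 i != 0.
  move: eu; rewrite unitmxE det_diag unitfE => /prodf_neq0; exact.
have -> : invmx (invmx P *m diag_mx e *m P) =
          invmx P *m diag_mx (\row_i (e 0 i)^-1) *m P.
  have nn : invmx P *m diag_mx e *m P \in unitmx.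
    by rewrite !unitmx_mul unitmx_inv Pu eu.
  apply: (can_inj (mulKmx nn)); rewrite mulmxV // !mulmxA mulmxK //.
  rewrite -(mulmxA (invmx P)) mulmx_diag.
  have -> : \row_j (e 0 j * (\row_i (e 0 i)^-1) 0 j) = const_mx 1.
    by apply/rowP=> j; rewrite [LHS]mxE [X in _ * X]mxE [RHS]mxE divff.
  by rewrite diag_const_mx mulmx1 mulVmx.
rewrite mxtrace_mulC mulmxA mulmxV // mul1mx mxtrace_diag.
by apply: eq_bigr => i _; rewrite !mxE.
Qed.

(** Over [R[i]] the matrix is Hermitian, hence unitarily diagonalizable with real eigenvalues. Both
    identities are proved there and pulled back along the injective map [toC]. *)
Lemma symmetric_spectrum (R : rcfType) n (A : 'M[R]_n) : A^T = A ->
  exists s : seq R, eigenvalues_of A s /\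
    forall c, c%:M + A \in unitmx ->
      \tr (invmx (c%:M + A)) = \sum_(x <- s) (c + x)^-1.
Proof.
move=> symA; pose toC := real_complex R; pose B := map_mx toC A.
have hermB : B \is hermsymmx.
  apply: realsym_hermsym.
    apply/is_hermitianmxP; rewrite expr0 scale1r map_mx_id //.
    by rewrite /B map_trmx symA.
  by apply/mxOverP => i j; rewrite mxE complex_real.
have dreal := hermitian_spectral_diag_real hermB.
have := orthomx_spectralP (hermitian_normalmx hermB).
set P := spectralmx B; set d := spectral_diag B => defB.
have Pu : P \in unitmx by apply: spectral_unit.
pose r i := complex.Re (d 0 i).
have rE i : toC (r i) = d 0 i by apply: RRe_real; apply: (mxOverP dreal).
exists (sort <=%R [seq r i | i : 'I_n]); split; first split.
- exact: sort_le_sorted.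
- apply: (map_poly_inj toC); rewrite map_char_poly -/B defB char_poly_conj //.
  rewrite char_poly_trig ?diag_mx_is_trig // rmorph_prod /=.
  rewrite (perm_big _ (permEl (perm_sort _ _))) /= big_image /=.
  apply: eq_bigr => i _; rewrite rmorphB /= map_polyX map_polyC /=.
  by rewrite mxE eqxx mulr1n -rE.
- move=> c cu; apply: (fmorph_inj toC).
  rewrite -trace_map_mx map_invmx map_mxD map_scalar_mx -/B defB.
  rewrite mxtrace_resolvent_diag //; last first.
    by rewrite -defB -map_scalar_mx -map_mxD map_unitmx.
  rewrite (perm_big _ (permEl (perm_sort _ _))) /= big_image /= rmorph_sum /=.
  by apply: eq_bigr => i _; rewrite fmorphV rmorphD /= -rE.
Qed.

Lemma sum_indicator (R : pzSemiRingType) (T : finType) (P : pred T) (i : T) :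
  \sum_(j | P j) (j == i)%:R = (P i)%:R :> R.
Proof.
rewrite big_mkcond (bigD1 i) //= eqxx big1 ?addr0 => [|j /negPf ->].
  by case: (P i).
by case: (P j).
Qed.

(** * The Laplacian, its spectrum and its resolvent *)

Section GraphLaplacian.
Variables (R : rcfType) (G : sgraph).
Implicit Types (f : G -> R) (x y u v : G) (a c : R).

Lemma sum_adj_antisym (g : G -> G -> R) :
  (forall x y, g y x = - g x y) -> \sum_x \sum_(y | adj x y) g x y = 0.
Proof.
move=> anti; set s := LHS; suff : s = - s by lra.
rewrite {1}/s (exchange_big_dep predT) //= -sumrN; apply: eq_bigr => x _.
rewrite -sumrN; apply: eq_big => [y|y _]; first by rewrite adj_sym.
exact: anti.
Qed.

Lemma laplacian_mulE f (i : 'I_#|G|) :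
  \sum_j laplacian R G i j * f (enum_val j) =
  \sum_(y | adj (enum_val i) y) (f (enum_val i) - f y).
Proof.
rewrite sumrB sumr_const.
under eq_bigr => j _ do rewrite !mxE mulrBl.
rewrite sumrB; congr (_ - _).
  rewrite (bigD1 i) //= eqxx mulr1n big1 ?addr0 => [|j /negPf ji].
    rewrite mulr_natl /degree; congr (_ *+ _).
    by apply: eq_card => y; rewrite !inE.
  by rewrite eq_sym ji mul0r.
rewrite (reindex _ (onW_bij _ (enum_val_bij G))) /= [RHS]big_mkcond /=.
by apply: eq_bigr => j _; case: adj; rewrite ?mul1r ?mul0r.
Qed.

Lemma laplacian_sym : (laplacian R G)^T = laplacian R G.
Proof.
rewrite /laplacian linearB /= tr_diag_mx; congr (_ - _).
by apply/matrixP=> i j; rewrite !mxE adj_sym.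
Qed.

Lemma dirichlet_ge0 f : 0 <= \sum_x \sum_(y | adj x y) (f x - f y) * f x.
Proof.
(* The summand is [f x ^+ 2 - f y ^+ 2], which is antisymmetric. Adding this zero sum turns the sum
   of squares into twice the Dirichlet form. *)
have anti : \sum_x \sum_(y | adj x y) (f x - f y) * (f x + f y) = 0.
  by apply: sum_adj_antisym => x y; ring.
have : 0 <= \sum_x \sum_(y | adj x y) (f x - f y) ^+ 2.
  by apply: sumr_ge0 => x _; apply: sumr_ge0 => y _; apply: sqr_ge0.
set s := \sum_x _; set t := (X in _ -> 0 <= X); suff -> : s = t + t by lra.
rewrite -[LHS]addr0 -anti /s /t -!big_split /=; apply: eq_bigr => x _.
by rewrite -!big_split /=; apply: eq_bigr => y _; ring.
Qed.

Lemma laplacian_eigenvalue_ge0 a : eigenvalue (laplacian R G) a -> 0 <= a.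
Proof.
case/eigenvalueP => v vL v0.
pose f x := v 0 (enum_rank x).
have fL x : \sum_(y | adj x y) (f x - f y) = a * f x.
  rewrite -(enum_rankK x) -laplacian_mulE.
  have := congr1 (fun w : 'rV_#|G| => w 0 (enum_rank x)) vL; rewrite !mxE.
  rewrite enum_rankK /f => <-; apply: eq_bigr => j _.
  by rewrite enum_valK mulrC -[in LHS]laplacian_sym mxE.
(* Pairing the eigenvector equation with [f] gives [a] times the sum of the squares of [f], which is
   positive since [v] is nonzero. *)
have := dirichlet_ge0 f; under eq_bigr => x _ do rewrite -mulr_suml fL -mulrA.
rewrite -mulr_sumr pmulr_lge0 // lt_def; apply/andP; split; last first.
  by apply: sumr_ge0 => x _; apply: sqr_ge0.
apply: contraNneq v0 => /eqP; rewrite psumr_eq0 => [/allP f0|x _]; last first.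
  exact: sqr_ge0.
apply/eqP/rowP => i; have := f0 (enum_val i); rewrite mem_index_enum.
by rewrite -expr2 sqrf_eq0 /f enum_valK mxE => /(_ isT)/eqP.
Qed.

Lemma laplacian_eigenvalue0 : (0 < #|G|)%N -> eigenvalue (laplacian R G) 0.
Proof.
move=> G0; apply/eigenvalueP; exists (const_mx 1).
  rewrite scale0r; apply/rowP => i; rewrite !mxE.
  have := laplacian_mulE (fun=> 1) i.
  rewrite [RHS]big1 => [L0|y _]; last by rewrite subrr.
  rewrite -[RHS]L0.
  apply: eq_bigr => j _.
  by rewrite -[in LHS]laplacian_sym [_^T _ _]mxE [const_mx _ _ _]mxE mulrC.
apply/eqP => /rowP /(_ (Ordinal G0)); rewrite !mxE => /eqP.
by rewrite oner_eq0.
Qed.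

(** If the matrix were singular, the negative number [-c] would be a Laplacian eigenvalue. *)
Lemma laplacian_shift_unit c : 0 < c -> c%:M + laplacian R G \in unitmx.
Proof.
move=> c0; rewrite -row_free_unit -kermx_eq0 addrC -[c]opprK raddfN.
apply/negPn/negP => /laplacian_eigenvalue_ge0; lra.
Qed.

Lemma sum_resolvent_spectrum c : (0 < #|G|)%N -> 0 < c ->
  \tr (invmx (c%:M + laplacian R G)) =
  c^-1 + \sum_(2 <= i < #|G|.+1) 1 / (c + mu R G i).
Proof.
move=> G0 c0; have [s [sP ->]] := symmetric_spectrum laplacian_sym; last first.
  exact: laplacian_shift_unit.
have specE : laplacian_spectrum R G = s.
  by apply: xget_unique => // t tP; apply: eigenvalues_of_inj tP sP.
case: sP => s_sorted charE.
have mem_s (x : R) : (x \in s) = eigenvalue (laplacian R G) x.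
  by rewrite eigenvalue_root_char charE root_prod_XsubC.
have size_s : size s = #|G|.
  apply: succn_inj; rewrite -(size_char_poly (laplacian R G)) charE.
  by rewrite size_prod_XsubC.
(* The sorted list consists of nonnegative numbers and contains 0, so it starts with 0. This head
   accounts for the separate term [c^-1]. *)
have s0 : nth 0 s 0 = 0.
  have: 0 \in s by rewrite mem_s laplacian_eigenvalue0.
  have: all (>= 0) s.
    by apply/allP => x; rewrite mem_s; apply: laplacian_eigenvalue_ge0.
  case: s s_sorted {charE specE mem_s size_s} => //= x s.
  rewrite le_path_sortedE => /andP[/allP xs _] /andP[x0 _].
  rewrite inE => /orP[/eqP //|/xs x0'].
  by apply/eqP; rewrite eq_le x0 x0'.
rewrite (big_nth 0) size_s big_ltn // s0 addr0 [in LHS]big_add1; congr (_ + _).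
(* [mu] counts from 1 and [nth] from 0: [mu] at [i + 2] is entry [i + 1] of [s]. *)
rewrite [RHS]big_add1 [RHS]big_add1; apply: eq_bigr => i _.
by rewrite /mu specE div1r.
Qed.

(** The resolvent as a kernel on vertices, ready to be a block of the kernel of the join. *)
Lemma laplacian_resolvent c : (0 < #|G|)%N -> 0 < c ->
  exists S : G -> G -> R,
    [/\ forall x u,
          c * S x u + \sum_(y | adj x y) (S x u - S y u) = (x == u)%:R,
        forall u, \sum_x S x u = c^-1
      & \sum_x S x x = c^-1 + \sum_(2 <= i < #|G|.+1) 1 / (c + mu R G i)].
Proof.
move=> G0 c0; pose M := c%:M + laplacian R G.
pose S (x u : G) : R := invmx M (enum_rank x) (enum_rank u); exists S.
have mulE (A B : 'M[R]_#|G|) i j :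
    ((c%:M + A) *m B) i j = c * B i j + \sum_k A i k * B k j.
  by rewrite mulmxDl mul_scalar_mx !mxE.
have SE x u : c * S x u + \sum_(y | adj x y) (S x u - S y u) = (x == u)%:R.
  rewrite -(enum_rankK x) -(laplacian_mulE (S^~ u)) !enum_rankK.
  have := mulmxV (laplacian_shift_unit c0).
  move=> /matrixP /(_ (enum_rank x) (enum_rank u)).
  rewrite mulE mxE (inj_eq enum_rank_inj) => <-; congr (_ + _).
  by apply: eq_bigr => j _; rewrite /S enum_valK.
split=> // [u|].
  (* Summed over [x], the Laplacian terms cancel in pairs and leave [c] times the column sum. *)
  have : \sum_x (c * S x u + \sum_(y | adj x y) (S x u - S y u)) = 1.
    under eq_bigr => x _ do rewrite SE.
    exact: (sum_indicator _ predT).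
  rewrite big_split /= sum_adj_antisym => [|x y]; last by rewrite opprB.
  rewrite addr0 -mulr_sumr => Sc; apply: (mulfI (lt0r_neq0 c0)).
  by rewrite Sc mulfV ?lt0r_neq0.
rewrite -sum_resolvent_spectrum // /mxtrace.
rewrite (reindex _ (onW_bij _ (enum_val_bij G))); apply: eq_bigr => j _.
by rewrite /S enum_valK.
Qed.

(** * The Kirchhoff index from a Green kernel *)

Lemma kirchhoff_green (M : G -> G -> R) (w : G -> R) :
    (forall x u, \sum_(y | adj x y) (M x u - M y u) = (x == u)%:R - w x) ->
  kirchhoff_index R G = #|G|%:R * \sum_u M u u - \sum_u \sum_v M u v.
Proof.
move=> ME.
have rE u v : resistance R u v = (M u u - M u v) + (M v v - M v u).
  rewrite (@resistanceE _ _ _ _ (fun x => M x u - M x v)); first by ring.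
  move=> x.
  transitivity (\sum_(y | adj x y) ((M x u - M y u) - (M x v - M y v))).
    by apply: eq_bigr => y _; ring.
  by rewrite sumrB !ME; ring.
(* [rE] splits the resistance into a term in [(u, v)] and its mirror image in [(v, u)]. The sum over
   unordered pairs thus becomes one over ordered pairs, with zero diagonal. *)
pose lo := fun u v : G => (enum_rank u < enum_rank v)%N.
transitivity (\sum_u \sum_v (M u u - M u v)).
  rewrite /kirchhoff_index.
  under eq_bigr => u _ do under eq_bigr => v _ do rewrite rE.
  under eq_bigr => u _ do rewrite big_split.
  rewrite big_split /=; set t := (X in _ + X).
  have -> : t = \sum_u \sum_(v | lo v u) (M u u - M u v).
    by rewrite /t (exchange_big_dep predT).
  rewrite -big_split; apply: eq_bigr => u _ /=.
  rewrite [RHS](bigID (lo u)) /=; congr (_ + _).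
  rewrite [RHS](bigD1 u) /= ?/lo ?ltnn // subrr add0r; apply: eq_bigl => v.
  by rewrite -leqNgt ltn_neqAle -(inj_eq enum_rank_inj) andbC.
under eq_bigr => u _ do rewrite sumrB sumr_const -mulr_natl.
by rewrite sumrB -mulr_sumr cardT -cardE.
Qed.

End GraphLaplacian.

Lemma sumr_constT (R : pzSemiRingType) (T : finType) (c : R) :
  \sum_(i : T) c = #|T|%:R * c.
Proof. by rewrite sumr_const mulr_natl. Qed.

(** * Sums over edges and their ends *)

Section Incidence.
Variables (R : rcfType) (G : sgraph).

(** Sending [y] to [[set x; y]] is a bijection from the neighbours of [x] to the edges at [x];
    injectivity uses the absence of loops. *)
Lemma sum_incident_edges (F : {set G} -> R) (x : G) :
  \sum_(e : edge G | x \in val e) F (val e) = \sum_(y | adj x y) F [set x; y].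
Proof.
rewrite -(big_sub_cond (mem (edges G)) (fun s => x \in s) F) /=.
have -> : \sum_(s in edges G | x \in s) F s =
          \sum_(s in [set [set x; y] | y in adj x]) F s.
  apply: eq_bigl => s; apply/andP/imsetP => [[]|[y xy ->]]; last first.
    by split; [apply/imsetP; exists (x, y) | rewrite set21].
    case/imsetP => -[y z] /= yz -> /set2P[->|->]; first by exists z.
    by exists y; [rewrite -topredE /= adj_sym | rewrite setUC].
rewrite big_imset //= => y z; rewrite -!topredE /= => xy xz eq_yz.
have: y \in [set x; z] by rewrite -eq_yz set22.
by case/set2P => // yx; rewrite yx adj_irrefl in xy.
Qed.

Lemma sum_adj_pair (g : G -> R) (x y : G) :
  adj x y -> \sum_(z in [set x; y]) g z = g x + g y.
Proof.
move=> xy; rewrite big_setU1 ?big_set1 // inE.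
by apply: contraTneq xy => ->; rewrite adj_irrefl.
Qed.

(** In matrix terms, [B B^T = D + A]. *)
Lemma sum_incident_ends (g : G -> R) (x : G) :
  \sum_(e : edge G | x \in val e) \sum_(z in val e) g z =
  \sum_(y | adj x y) (g x + g y).
Proof.
rewrite (sum_incident_edges (fun s => \sum_(z in s) g z)).
by apply: eq_bigr => y xy; apply: sum_adj_pair.
Qed.

Lemma card_edge (e : edge G) : #|val e| = 2.
Proof.
case: e => _ /= /imsetP[[x y] /= xy ->]; rewrite cards2.
by case: eqP xy => // ->; rewrite -topredE /= adj_irrefl.
Qed.

Lemma sum_edge_const (e : edge G) (c : R) : \sum_(z in val e) c = 2 * c.
Proof. by rewrite sumr_const card_edge mulr_natl. Qed.

Variable r : nat.
Hypothesis regG : regular G r.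

Lemma sum_adj_const (x : G) (c : R) : \sum_(y | adj x y) c = r%:R * c.
Proof.
rewrite sumr_const mulr_natl -(regG x) /degree; congr (_ *+ _).
by apply: eq_card => y; rewrite !inE.
Qed.

Lemma sum_edge_ends (g : G -> R) :
  \sum_(e : edge G) \sum_(z in val e) g z = r%:R * \sum_z g z.
Proof.
rewrite (exchange_big_dep predT) //= mulr_sumr; apply: eq_bigr => z _.
by rewrite (sum_incident_edges (fun=> g z)) sum_adj_const.
Qed.

Lemma handshake : 2 * #|{: edge G}|%:R = r%:R * #|G|%:R :> R.
Proof.
have := sum_edge_ends (fun=> 1); under eq_bigr => e _ do rewrite sum_edge_const.
by rewrite !sumr_const -mulrnAr.
Qed.

(** This is [B B^T = 2 r - L] rearranged as [(2 + t) r - B B^T = r t + L]. With [t = n2] it yields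
    the current law at the original vertices of the join. *)
Lemma sum_incident_defect (g : G -> R) (t : R) (x : G) :
  \sum_(e : edge G | x \in val e) ((2 + t) * g x - \sum_(z in val e) g z) =
  r%:R * t * g x + \sum_(y | adj x y) (g x - g y).
Proof.
rewrite sumrB sum_incident_ends.
rewrite (sum_incident_edges (fun=> (2 + t) * g x)) -sumrB.
rewrite -mulrA -(sum_adj_const x) -big_split /=.
by apply: eq_bigr => y _; ring.
Qed.

End Incidence.

(** * The Green kernel of the join *)

Section GreenKernel.
Variables (R : rcfType) (G1 G2 : sgraph) (r : nat).
Hypothesis r_gt0 : (0 < r)%N.
Hypotheses (G1_gt0 : (0 < #|G1|)%N) (G2_gt0 : (0 < #|G2|)%N).
Hypothesis regG : regular G1 r.

Local Notation rR := (r%:R : R).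
Local Notation n1 := (#|G1|%:R : R).
Local Notation n2 := (#|G2|%:R : R).
Local Notation m := (#|{: edge G1}|%:R : R).

Variables (S : G1 -> G1 -> R) (K : G2 -> G2 -> R).
Hypothesis SE : forall x u,
  rR * n2 * S x u + \sum_(y | adj x y) (S x u - S y u) = (x == u)%:R.
Hypothesis S1 : forall u, \sum_x S x u = (rR * n2)^-1.
Hypothesis KE : forall x u,
  m * K x u + \sum_(y | adj x y) (K x u - K y u) = (x == u)%:R.
Hypothesis K1 : forall u, \sum_x K x u = m^-1.

(** The entry [(x, f)] of [S B]. *)
Definition edge_potential (f : edge G1) (x : G1) : R := \sum_(t in val f) S x t.

(** In column [b] a unit current enters at [b] and leaves evenly through [G2]. If [b] is in the
    subdivision, [G2] is grounded at 0. If [b] is a vertex [v] of [G2], the subdivision sits at one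
    potential, the mean of [K y v] over [y]. *)
Definition join_green (a b : subdivision_edge_join G1 G2) : R :=
  match a, b with
  | inl (inl x), inl (inl u) => (2 + n2) * S x u
  | inl (inl x), inl (inr f) => edge_potential f x
  | inl (inr e), inl (inl u) => \sum_(z in val e) S z u
  | inl (inr e), inl (inr f) =>
      ((e == f)%:R + \sum_(z in val e) edge_potential f z) / (2 + n2)
  | inl _, inr _ => (n2 * m)^-1
  | inr _, inl _ => 0
  | inr y, inr v => K y v
  end.

Let r0 : rR != 0. Proof. by rewrite pnatr_eq0 -lt0n. Qed.
Let n2_0 : n2 != 0. Proof. by rewrite pnatr_eq0 -lt0n. Qed.
Let n2_2 : 2 + n2 != 0. Proof. by rewrite -natrD pnatr_eq0. Qed.
Let m0 : m != 0.
Proof.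
apply/negP => /eqP m_0.
have := handshake R regG; rewrite m_0 mulr0 => /esym/eqP.
by rewrite mulf_eq0 (negPf r0) pnatr_eq0 eqn0Ngt G1_gt0.
Qed.

Lemma edge_potentialE f x :
  rR * n2 * edge_potential f x
    + \sum_(y | adj x y) (edge_potential f x - edge_potential f y) =
  (x \in val f)%:R.
Proof.
have -> : \sum_(y | adj x y) (edge_potential f x - edge_potential f y) =
          \sum_(t in val f) \sum_(y | adj x y) (S x t - S y t).
  by rewrite exchange_big; apply: eq_bigr => y _; rewrite -sumrB.
rewrite mulr_sumr -big_split /=; under eq_bigr => t _ do rewrite SE.
under eq_bigr => t _ do rewrite eq_sym; exact: sum_indicator.
Qed.

Lemma sum_edge_potential f : \sum_x edge_potential f x = 2 / (rR * n2).
Proof.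
rewrite exchange_big /=; under eq_bigr => t _ do rewrite S1.
exact: sum_edge_const.
Qed.

(** The trace of [B^T S B] is that of [B B^T S]. Here [B B^T = (2 + n2) r - (r n2 + L1)], and
    [(r n2 + L1) S] is the identity. *)
Lemma sum_diag_ends :
  \sum_(e : edge G1) \sum_(z in val e) edge_potential e z =
  (2 + n2) * rR * (\sum_x S x x) - n1.
Proof.
rewrite /edge_potential; under eq_bigr => e _ do rewrite exchange_big /=.
rewrite (exchange_big_dep predT) //=.
have -> : n1 = \sum_(t : G1) 1 by rewrite sumr_constT mulr1.
rewrite mulr_sumr -sumrB; apply: eq_bigr => t _.
have := sum_incident_defect regG (S^~ t) n2 t; rewrite SE eqxx sumrB.
rewrite (sum_incident_edges (fun=> (2 + n2) * S t t)) (sum_adj_const regG) /=.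
set B := \sum_(e | _) _ => H; rewrite -/B.
lra.
Qed.

Lemma join_greenE (a b : subdivision_edge_join G1 G2) :
  \sum_(c | adj a c) (join_green a b - join_green c b) =
  (a == b)%:R - (if a is inr _ then n2^-1 else 0).
Proof.
rewrite big_sumType big_sumType /=.
case: a => [[x|e]|y] /=.
- rewrite big_pred0 // add0r [X in _ + X]big_pred0 => [|z]; last by rewrite inE.
  rewrite addr0 subr0; case: b => [[u|f]|v] /=.
  + by rewrite (sum_incident_defect regG (S^~ u)) SE.
  (* Scaling by [2 + n2] clears the denominators. The [e == f] terms then sum to the right side of
     [edge_potentialE] and cancel it. *)
  + apply: (mulfI n2_2).
    rewrite mulr_sumr.
    transitivity (\sum_(e : edge G1 | x \in val e)
        ((2 + n2) * edge_potential f x - \sum_(z in val e) edge_potential f z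
          - (e == f)%:R)).
      by apply: eq_bigr => e _; field.
    rewrite sumrB (sum_incident_defect regG) edge_potentialE mulr0.
    by rewrite (sum_indicator _ (fun e : edge G1 => x \in val e)) subrr.
  + by rewrite big1 // => e _; rewrite subrr.
- rewrite [X in _ + X + _]big_pred0 // addr0.
  under [X in _ + X = _]eq_bigl => z do rewrite inE.
  rewrite subr0; case: b => [[u|f]|v] /=.
  + by rewrite sumrB sum_edge_const subr0 sumr_constT -mulr_sumr; ring.
  + rewrite sumrB sum_edge_const subr0 sumr_constT.
    by rewrite -[_ == _]/(e == f); field.
  + rewrite sumrB sum_edge_const sumrB sumr_constT K1.
    by field; rewrite ?m0 ?n2_0.
(* A vertex of [G2] sees all [m] inserted vertices; in the columns of [G2] they supply the shift by
   [m] in [KE]. *)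
- rewrite [X in X + _ + _]big_pred0 => [|z]; last by rewrite inE.
  rewrite add0r.
  under [X in X + _ = _]eq_bigl => z do rewrite inE.
  case: b => [[u|f]|v] /=.
  + rewrite sumrB big1 // sub0r.
    rewrite [X in _ + X]big1 ?addr0 => [|z _]; last by rewrite subrr.
    by rewrite (sum_edge_ends regG) S1; field; rewrite r0 n2_0.
  + rewrite [X in _ + X]big1 ?addr0 => [|z _]; last by rewrite subrr.
    rewrite sumrB big1 // -mulr_suml big_split /= (sum_indicator _ predT).
    rewrite (sum_edge_ends regG) sum_edge_potential /=.
    by field; rewrite ?r0 ?n2_0 ?n2_2.
  + rewrite sumrB !sumr_constT addrAC KE.
    by congr (_ - _); field; rewrite ?m0 ?n2_0.
Qed.

(** The inserted block has trace [(m + tr (B^T S B)) / (2 + n2)], which [sum_diag_ends] turns into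
    [r tr S + (m - n1) / (2 + n2)]. *)
Lemma sum_join_green_diag :
  \sum_a join_green a a =
  (2 + n2 + rR) * (\sum_x S x x) + (m - n1) / (2 + n2) + \sum_x K x x.
Proof.
rewrite big_sumType big_sumType /= -mulr_sumr -mulr_suml big_split /=.
under [X in (X + _) / _]eq_bigr => e _ do rewrite eqxx.
rewrite sumr_constT sum_diag_ends mulr1.
by congr (_ + _); field.
Qed.

Lemma sum_join_green :
  \sum_a \sum_b join_green a b =
  n1 * (2 + n2 + rR) / (rR * n2) + m * (2 / (rR * n2) + n2^-1)
   + n2 * ((n1 + m) / (n2 * m) + m^-1).
Proof.
(* Summing by columns: the column sums are constant on each of the three vertex classes, because
   those of [S] and [K] are. *)
rewrite exchange_big big_sumType big_sumType /=.
congr (_ + _ + _).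
- transitivity (\sum_(x : G1) (2 + n2 + rR) / (rR * n2)); last first.
    by rewrite sumr_constT mulrA.
  apply: eq_bigr => x _; rewrite big_sumType big_sumType /=.
  rewrite -mulr_sumr S1 (sum_edge_ends regG) S1 big1 // addr0; field.
  by rewrite r0 n2_0.
- transitivity (\sum_(f : edge G1) (2 / (rR * n2) + n2^-1)); last first.
    by rewrite sumr_constT.
  apply: eq_bigr => f _; rewrite big_sumType big_sumType /=.
  rewrite sum_edge_potential -mulr_suml big_split /= (sum_indicator _ predT).
  rewrite (sum_edge_ends regG) sum_edge_potential big1 // addr0 /=.
  by field; rewrite ?r0 ?n2_0 ?n2_2.
- transitivity (\sum_(v : G2) ((n1 + m) / (n2 * m) + m^-1)); last first.
    by rewrite sumr_constT.
  apply: eq_bigr => v _; rewrite big_sumType big_sumType /=.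
  by rewrite !sumr_constT K1 mulrDl.
Qed.

End GreenKernel.

(** * Assembling the closed formula *)

Lemma kirchhoff_join_arith (F : realFieldType) (n1 m n2 r X1 X2 : F) :
    0 < m -> 0 < n2 -> 0 < r -> 2 * m = r * n1 ->
  (m + n1 + n2) *
    ((2 + n2 + r) * ((r * n2)^-1 + X1) + (m - n1) / (2 + n2) + (m^-1 + X2))
  - (n1 * (2 + n2 + r) / (r * n2) + m * (2 / (r * n2) + n2^-1)
     + n2 * ((n1 + m) / (n2 * m) + m^-1)) =
  (m + n1 + n2) *
    ((m - n1) / (2 + n2) + (2 + r + m + n2) / (r * n2 + r * m + 2 * m)
     + X2 + (2 + r + n2) * X1).
Proof.
move=> m0 n20 r0 hs.
(* The handshake relation eliminates [n1]; what remains is a rational identity in independent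
   variables, with [X1] and [X2] in place of the spectral sums. *)
have -> : n1 = 2 * m / r by rewrite hs mulrAC divff ?mul1r ?lt0r_neq0.
have D0 : 0 < r * n2 + r * m + 2 * m by rewrite !addr_gt0 ?mulr_gt0.
field.
have c0 : 0 < 2 + n2 by rewrite addr_gt0.
by rewrite !lt0r_neq0.
Qed.

Theorem corollary3p7 (R : rcfType) (G1 G2 : sgraph) (n1 m1 r1 n2 : nat)
    (n1_gt0 : (0 < n1)%N) (r1_gt0 : (0 < r1)%N) (n2_gt0 : (0 < n2)%N)
    (card_V1 : #|G1| = n1) (card_E1 : #|edges G1| = m1)
    (reg_G1 : regular G1 r1) (card_V2 : #|G2| = n2) :
  kirchhoff_index R (subdivision_edge_join G1 G2) =
  (m1%:R + n1%:R + n2%:R) *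
    ((m1%:R - n1%:R) / (2 + n2%:R)
     + (2 + r1%:R + m1%:R + n2%:R) /
         (r1%:R * n2%:R + r1%:R * m1%:R + 2 * m1%:R)
     + \sum_(2 <= i < n2.+1) 1 / (m1%:R + mu R G2 i)
     + \sum_(2 <= i < n1.+1)
         (2 + r1%:R + n2%:R) / (r1%:R * n2%:R + mu R G1 i)).
Proof.
subst n1 n2.
have card_E : #|{: edge G1}| = m1 by rewrite card_sig.
have hs := handshake R reg_G1; rewrite card_E in hs.
have r0 : 0 < r1%:R :> R by rewrite ltr0n.
have n20 : 0 < #|G2|%:R :> R by rewrite ltr0n.
have m0 : 0 < m1%:R :> R.
  by rewrite -(pmulr_rgt0 _ (ltr0n _ 2)) hs mulr_gt0 ?ltr0n.
have [S [SE S1 trS]] := laplacian_resolvent n1_gt0 (mulr_gt0 r0 n20).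
have [K [KE K1 trK]] := laplacian_resolvent n2_gt0 m0.
rewrite -card_E in KE K1.
rewrite (kirchhoff_green (join_greenE r1_gt0 n1_gt0 n2_gt0 reg_G1 SE S1 KE K1)).
rewrite (sum_join_green_diag reg_G1 K SE).
rewrite (sum_join_green r1_gt0 n2_gt0 reg_G1 S1 K1).
rewrite trS trK !card_sum card_E.
set X1 := \sum_(2 <= i < #|G1|.+1) 1 / _.
have -> : \sum_(2 <= i < #|G1|.+1)
    (2 + r1%:R + #|G2|%:R) / (r1%:R * #|G2|%:R + mu R G1 i) =
    (2 + r1%:R + #|G2|%:R) * X1.
  by rewrite mulr_sumr; apply: eq_bigr => i _; rewrite div1r.
rewrite -(kirchhoff_join_arith _ _ m0 n20 r0 hs) !natrD.
by rewrite (addrC #|G1|%:R).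
Qed.
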